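(* Let $r$ be the rank of the kernel $\mathcal K$, and let $\pi=[p_1,\ldots,p_n]$ be the invariant distribution of $A$. Define vectors $u_\ell$, indexed by the $\ell$-element subsets of $\{1,\ldots,n\}$, inductively for $\ell=r-1,\ldots,1$, starting from $u_r$ given by $u_r^{\top}=\Omega_r u^{\top}$, by $$u_\ell(I)=\sum_{i\notin I}p_i\,u_{\ell+1}(I\cup\{i\}).$$ Then for each $1\le\ell\le r$, $u_\ell^{\top}$ is a multiple of $\Omega_\ell u^{\top}$, where $u$ denotes the all-ones row vector of the appropriate dimension.
   Context: The setting: a directed graph on the vertex set $\{1,\ldots,n\}$ in which each vertex has out-degree $d$, with adjacency matrix $\mathcal A$ such that $A=d^{-1}\mathcal A$ is irreducible and aperiodic; $\pi$ is the unique probability row vector with $\pi A=\pi$. $\mathcal A=C_1+\cdots+C_d$, where each $C_i$ is a binary stochastic matrix (a $0$-$1$ matrix with exactly one $1$ in each row). $\mathcal S$ is the finite semigroup generated by the $C_i$ under matrix multiplication, and $\mathcal K$ is its kernel (minimal ideal, consisting of the elements of minimal rank $r$). Each binary stochastic matrix $F$ corresponds to the function $f$ with $F_{ij}=1$ iff $f(i)=j$; $F^{(\ell)}$ is the matrix indexed by the $\ell$-element subsets $I,J$ of the vertex set with $F^{(\ell)}_{IJ}=1$ if $f(I)=J$ and $0$ otherwise. Let $A_\ell=\frac1d\sum_iC_i^{(\ell)}$ and $\Omega_\ell=\lim_{N\to\infty}\frac1N\sum_{m=1}^NA_\ell^m$ (which exists). *)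

(* Defs.v *)
From HB Require Import structures.
From mathcomp Require Import all_boot all_order all_algebra.
From mathcomp Require Import all_classical all_reals all_analysis.
Import Order.TTheory GRing.Theory Num.Theory.
Import numFieldNormedType.Exports.

Set Implicit Arguments.
Unset Strict Implicit.
Unset Printing Implicit Defensive.

Local Open Scope classical_set_scope.
Local Open Scope ring_scope.

(* [adj i j] is the number of edges from [i] to [j]; simple digraphs are the
   case of 0-1 entries. *)
Definition out_regular (n d : nat) (adj : 'M[nat]_n) : Prop :=
  forall i : 'I_n, (\sum_j adj i j)%N = d.

Definition real_adj (R : realType) (n : nat) (adj : 'M[nat]_n) : 'M[R]_n :=
  map_mx (fun k : nat => k%:R) adj.

Definition irreducible_mx (R : realType) (n : nat) (A : 'M[R]_n) : Prop :=
  forall i j : 'I_n, exists2 k : nat, (0 < k)%N & 0 < (A ^+ k) i j.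

(* The gcd of the set of return times of each state is 1. *)
Definition aperiodic_mx (R : realType) (n : nat) (A : 'M[R]_n) : Prop :=
  forall (i : 'I_n) (g : nat),
    (forall k : nat, (0 < k)%N -> 0 < (A ^+ k) i i -> (g %| k)%N) -> g = 1%N.

Definition invariant_distribution (R : realType) (n : nat)
    (A : 'M[R]_n) (p : 'rV[R]_n) : Prop :=
  [/\ forall i, 0 <= p 0 i, \sum_i p 0 i = 1 & p *m A = p].

Definition binary_stochastic (R : realType) (n : nat) (F : 'M[R]_n) : Prop :=
  (forall i j, F i j = 0 \/ F i j = 1) /\ (forall i, exists! j, F i j = 1).

(* The function of a binary stochastic matrix; the default value [i] is
   irrelevant since every row of such a matrix contains a 1. *)
Definition fun_of_mx (R : realType) (n : nat) (F : 'M[R]_n) (i : 'I_n) : 'I_n :=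
  odflt i [pick j | F i j == 1].

Definition generated_semigroup (R : realType) (n : nat) (G : set 'M[R]_n) :
    set 'M[R]_n :=
  smallest [set S | forall M N, S M -> S N -> S (M *m N)] G.

Definition semigroup_ideal (R : realType) (n : nat) (S J : set 'M[R]_n) : Prop :=
  [/\ J !=set0, J `<=` S &
      forall M N, S M -> J N -> J (M *m N) /\ J (N *m M)].

Definition semigroup_kernel (R : realType) (n : nat) (S K : set 'M[R]_n) :
    Prop :=
  semigroup_ideal S K /\
  forall J, semigroup_ideal S J -> J `<=` K -> J = K.

(* MathComp matrices are indexed by ordinals, so the l-element subsets of 'I_n
   are enumerated by 'I_(nsub n l). *)
Definition nsub (n l : nat) : nat := #|[set I : {set 'I_n} | #|I| == l]%SET|.

Definition nth_subset (n l : nat) (a : 'I_(nsub n l)) : {set 'I_n} :=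
  enum_val a.

Definition subset_vec (R : realType) (n l : nat) (w : {set 'I_n} -> R) :
    'rV[R]_(nsub n l) :=
  \row_a w (nth_subset a).

Definition ones (R : realType) (m : nat) : 'rV[R]_m := const_mx 1.

Definition subset_mx (R : realType) (n l : nat) (F : 'M[R]_n) :
    'M[R]_(nsub n l) :=
  \matrix_(a, b) ((fun_of_mx F @: nth_subset a)%SET == nth_subset b)%:R.

Definition level_mx (R : realType) (n d : nat) (C : 'I_d -> 'M[R]_n) (l : nat) :
    'M[R]_(nsub n l) :=
  d%:R^-1 *: \sum_i subset_mx l (C i).

Definition Omega (R : realType) (n d : nat) (C : 'I_d -> 'M[R]_n) (l : nat) :
    'M[R]_(nsub n l) :=
  lim ((fun N : nat =>
          N%:R^-1 *: \sum_(1 <= m < N.+1) level_mx C l ^+ m) @ \oo).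

(* Main.v *)
Require Import Defs.
From mathcomp Require Import all_boot all_order all_algebra.
From mathcomp Require Import all_classical all_reals all_analysis.
Import Order.TTheory GRing.Theory Num.Theory.
Import numFieldNormedType.Exports.

(** Let a word w = i_1 ... i_m act on the vertices by applying the functions of
    C_(i_1), ..., C_(i_m) one after the other.  Row I of the m-th power of the
    level-l matrix has as its sum the proportion of words of length m that are
    injective on I ([level_mx_pow_rowsum]).  So the entry at I of Omega_l
    applied to the ones vector is the Cesaro limit h(I) of these proportions
    ([Omega_ones_cvg]), and everything takes place in the averages over words.

    Call a word good if its image has r points, the least possible number.
    Three facts give the theorem.

    - All the nonempty fibers of a good word have the same mass 1/r for the
      invariant distribution ([minimal_rank_fiber_mass]).  This is Friedman's
      argument: averaging over one letter preserves the mass of a set, so the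
      property of being a fiber of maximal mass passes to all preimages, and
      irreducibility makes all r fibers of one good word such preimages.  So
      the maximal mass is 1/r, and since the r fibers of any good word have
      total mass 1, each of them attains it.

    - So if a good word is injective on I, the points i that keep it injective
      on I + i are those outside the #|I| fibers that meet I, and they have
      total mass 1 - #|I|/r ([mean_injective_extension]).

    - The proportion of words of length m that are not good is summable in m
      ([sum_word_mean_bounded]), so these words do not contribute to a Cesaro
      limit.  Thus the sum of p_i h(I + i) over i outside I is
      (1 - #|I|/r) h(I) ([limit_extension_identity]).

    By descending induction u_l = x_l h on the l-element sets, with x_r = 1 and
    x_l = (1 - l/r) x_(l+1).  The limit defining Omega_l has to be shown to
    exist: this is the mean ergodic theorem for a matrix A whose powers are
    bounded, which holds because the space is the direct sum of the kernel and
    the image of A - 1 ([cvg_cesaro_expmx]). *)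

Set Implicit Arguments.
Unset Strict Implicit.
Unset Printing Implicit Defensive.

Local Open Scope ring_scope.

(** * Words and averages over words *)

(** The first letter acts first: the matrices of functions act on row vectors,
    so the word read from left to right is the product of its matrices. *)
Definition word_act (d : nat) (T : Type) (c : 'I_d -> T -> T) (w : seq 'I_d) :
  T -> T := foldl (fun x i => c i x) ^~ w.

Lemma word_act_cat (d : nat) (T : Type) (c : 'I_d -> T -> T) w v x :
  word_act c (w ++ v) x = word_act c v (word_act c w x).
Proof. by rewrite /word_act foldl_cat. Qed.

(** The average over the d^m words of length m.  The recursion on the first
    letter mirrors the expansion of a power of an average of d matrices. *)
Fixpoint word_mean (R : realFieldType) (d m : nat) (phi : seq 'I_d -> R) : R :=
  if m is k.+1 then
    d%:R^-1 * \sum_i word_mean k (fun w => phi (i :: w))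
  else phi [::].


Lemma eq_word_mean (R : realFieldType) (d m : nat) (phi psi : seq 'I_d -> R) :
  phi =1 psi -> word_mean m phi = word_mean m psi.
Proof.
elim: m phi psi => [|m IH] phi psi e /=; first exact: e.
by congr (_ * _); apply: eq_bigr => i _; apply: IH => w; apply: e.
Qed.

Lemma ler_word_mean (R : realFieldType) (d m : nat) (phi psi : seq 'I_d -> R) :
  (forall w, phi w <= psi w) -> word_mean m phi <= word_mean m psi.
Proof.
elim: m phi psi => [|m IH] phi psi e /=; first exact: e.
by rewrite ler_wpM2l ?invr_ge0 // ler_sum // => i _; apply: IH.
Qed.

Lemma word_mean_sum (R : realFieldType) (d m : nat) (I : Type) (s : seq I)
    (P : pred I) (phi : I -> seq 'I_d -> R) :
  word_mean m (fun w => \sum_(i <- s | P i) phi i w) =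
  \sum_(i <- s | P i) word_mean m (phi i).
Proof.
elim: m phi => [//|m IH] phi /=.
under eq_bigr do rewrite IH.
by rewrite exchange_big /= mulr_sumr.
Qed.

Lemma word_meanZ (R : realFieldType) (d m : nat) (a : R)
    (phi : seq 'I_d -> R) :
  word_mean m (fun w => a * phi w) = a * word_mean m phi.
Proof.
elim: m phi => [//|m IH] phi /=.
under eq_bigr do rewrite IH.
by rewrite -mulr_sumr mulrCA.
Qed.

Lemma word_meanD (R : realFieldType) (d m : nat) (phi psi : seq 'I_d -> R) :
  word_mean m (fun w => phi w + psi w) = word_mean m phi + word_mean m psi.
Proof.
elim: m phi psi => [//|m IH] phi psi /=.
under eq_bigr do rewrite IH.
by rewrite big_split /= mulrDr.
Qed.

Lemma word_meanB (R : realFieldType) (d m : nat) (phi psi : seq 'I_d -> R) :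
  word_mean m (fun w => phi w - psi w) = word_mean m phi - word_mean m psi.
Proof.
rewrite -[- word_mean m psi]mulN1r -word_meanZ -word_meanD.
by apply: eq_word_mean => w; rewrite mulN1r.
Qed.

Lemma word_mean_cst (R : realFieldType) (d m : nat) (a : R) :
  (0 < d)%N -> word_mean m (fun _ : seq 'I_d => a) = a.
Proof.
move=> d0; elim: m => [//|m IH] /=.
by rewrite IH sumr_const card_ord -[a *+ d]mulr_natl mulKf // pnatr_eq0 -lt0n.
Qed.

Lemma word_mean_ge0 (R : realFieldType) (d m : nat) (phi : seq 'I_d -> R) :
  (forall w, 0 <= phi w) -> 0 <= word_mean m phi.
Proof.
elim: m phi => [|m IH] phi e /=; first exact: e.
by rewrite mulr_ge0 ?invr_ge0 // sumr_ge0 // => i _; apply: IH.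
Qed.

Lemma word_mean_gt0 (R : realFieldType) (d : nat) (phi : seq 'I_d -> R)
    (w : seq 'I_d) :
  (forall v, 0 <= phi v) -> 0 < phi w -> 0 < word_mean (size w) phi.
Proof.
elim: w phi => [//|i w IH] phi phi0 phiw /=.
have d0 : (0 < d)%N by case: (d) i {IH phi phi0 phiw w} => [[]|].
rewrite mulr_gt0 ?invr_gt0 ?ltr0n // (bigD1 i) //=.
rewrite ltr_pwDl //; first exact: (IH (fun v => phi (i :: v))).
by apply: sumr_ge0 => j _; apply: word_mean_ge0.
Qed.

Lemma word_mean_add (R : realFieldType) (d m k : nat) (phi : seq 'I_d -> R) :
  word_mean (m + k) phi =
  word_mean m (fun w => word_mean k (fun v => phi (w ++ v))).
Proof.
elim: m phi => [//|m IH] phi; rewrite addSn /=.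
by congr (_ * _); apply: eq_bigr => i _; rewrite IH.
Qed.

(** A bad word has only bad factors, so the proportion q_m of bad words satisfies
    q_(m+k) <= q_k q_m, and q_k < 1 for the length k of a word that is not bad.
    Summing over m gives S <= k + q_k S for every partial sum S. *)
Lemma sum_word_mean_bounded (R : realFieldType) (d : nat) (bad : pred (seq 'I_d))
    (w0 : seq 'I_d) :
  (0 < d)%N -> (forall w v, bad (w ++ v) -> bad w && bad v) -> ~~ bad w0 ->
  exists B : R, forall N,
    \sum_(1 <= m < N.+1) word_mean m (fun w => (bad w)%:R) <= B.
Proof.
move=> d0 hbad hw0.
pose q m : R := word_mean m (fun w => (bad w)%:R).
have bad01 w : 0 <= ((bad w)%:R : R) <= 1 by case: (bad w); rewrite ?lexx ler01.
have q0 m : 0 <= q m by apply: word_mean_ge0 => w; case/andP: (bad01 w).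
have q1 m : q m <= 1.
  rewrite -(word_mean_cst m 1 d0).
  by apply: ler_word_mean => w; case/andP: (bad01 w).
pose k := size w0.
have qk : q k < 1.
  rewrite -subr_gt0 -(word_mean_cst k 1 d0) -word_meanB.
  by apply: word_mean_gt0 => [v|]; rewrite ?subr_ge0 ?(negbTE hw0) ?subr0 //;
     case/andP: (bad01 v).
have qD m : q (m + k)%N <= q k * q m.
  rewrite /q word_mean_add -word_meanZ; apply: ler_word_mean => w.
  rewrite mulrC -word_meanZ; apply: ler_word_mean => v.
  have := hbad w v; case: (bad (w ++ v)) => [/(_ isT)/andP[-> ->]|_].
    by rewrite mulr1.
  by rewrite mulr_ge0.
exists (k%:R / (1 - q k)) => N.
rewrite ler_pdivlMr ?subr_gt0 // mulrBr mulr1 lerBlDr.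
have -> : \sum_(1 <= m < N.+1) q m = \sum_(m < N) q m.+1.
  by rewrite big_add1 /= big_mkord.
have le_shift : \sum_(m < N) q m.+1 <= \sum_(m < k + N) q m.+1.
  rewrite [X in _ <= X](_ : _ = \sum_(0 <= m < k + N) q m.+1); last first.
    by rewrite big_mkord.
  rewrite (big_cat_nat (leq0n N)) ?leq_addl //= big_mkord lerDl.
  by rewrite big_nat_cond sumr_ge0.
apply: le_trans le_shift _; rewrite big_split_ord /= lerD //.
  rewrite -[X in _ <= X%:R](card_ord k) -sum1_card natr_sum.
  by apply: ler_sum => i _; apply: q1.
rewrite mulrC mulr_sumr; apply: ler_sum => i _.
by rewrite addnC -addSn qD.
Qed.

(** * Fibers of the words of minimal rank *)

Definition mass (R : realFieldType) (T : finType) (p : T -> R) (B : {set T}) : R :=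
  \sum_(x in B) p x.

Lemma card_word_act_cat (d : nat) (T : finType) (c : 'I_d -> T -> T) w v :
  (#|word_act c (w ++ v) @: [set: T]| <= #|word_act c w @: [set: T]| /\
   #|word_act c (w ++ v) @: [set: T]| <= #|word_act c v @: [set: T]|)%N.
Proof.
have e : word_act c (w ++ v) @: [set: T] = word_act c v @: (word_act c w @: [set: T]).
  rewrite -imset_comp; apply: eq_imset => x /=; exact: word_act_cat.
split; rewrite e; first exact: leq_imset_card.
by apply: subset_leq_card; apply: imsetS; exact: finset.subsetT.
Qed.

Lemma sum_fibers (R : realFieldType) (T : finType) (p : T -> R) (f : T -> T)
    (J : {set T}) :
  \sum_(x | f x \in J) p x = \sum_(j in J) mass p (f @^-1: [set j]).
Proof.
rewrite (partition_big f (mem J)) //=; apply: eq_bigr => j jJ.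
by apply: eq_bigl => x; rewrite !inE; case: eqP => [->|]; rewrite ?jJ // andbF.
Qed.

(** Friedman's theorem.  Take a fiber B of maximal mass M among all the fibers of
    words of minimal rank, say of the word g.  The preimages of B under the d
    letters are fibers again and their masses have average M, so all have mass M,
    and so has the preimage of B under any word.  For a fiber of g, a word
    w that moves its image point into B exhibits it as the preimage of B under
    g ++ w.  So the r fibers of g have mass M and M = 1/r; any other word of
    minimal rank has r fibers of mass at most 1/r and total mass 1. *)
Lemma minimal_rank_fiber_mass (R : realFieldType) (T : finType) (d r : nat)
    (c : 'I_d -> T -> T) (p : T -> R) :
  (0 < d)%N -> \sum_x p x = 1 ->
  (forall B : {set T}, \sum_i mass p (c i @^-1: B) = d%:R * mass p B) ->
  (forall x y, exists w, word_act c w x = y) ->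
  (forall w, r <= #|word_act c w @: [set: T]|)%N ->
  forall w, #|word_act c w @: [set: T]| = r ->
  forall j, j \in word_act c w @: [set: T] ->
  mass p (word_act c w @^-1: [set j]) = r%:R^-1.
Proof.
move=> d0 p1 pinv trans rmin w1 rw1 j1 hj1.
pose isfib (B : {set T}) := `[< exists w j, #|word_act c w @: [set: T]| = r /\
  B = word_act c w @^-1: [set j] >].
have fib1 : isfib (word_act c w1 @^-1: [set j1]) by apply/asboolP; exists w1, j1.
case: (Order.TotalTheory.arg_maxP (mass p) fib1) => B fibB maxB'.
have maxB X : isfib X -> mass p X <= mass p B by exact: maxB'.
have max_pre w B' : isfib B' -> mass p B' = mass p B ->
    mass p (word_act c w @^-1: B') = mass p B.
  elim: w B' => [|i w IH] B' fB' mB'.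
    by rewrite -mB'; congr mass; apply/setP => x; rewrite !inE.
  (* The rank cannot drop, so a fiber pulls back to a fiber of minimal rank. *)
  have fpre k X : isfib X -> isfib (c k @^-1: X).
    move=> /asboolP[v [j [rv ->]]]; apply/asboolP; exists (k :: v), j; split.
      apply/eqP; rewrite eqn_leq rmin andbT -[X in (_ <= X)%N]rv.
      by have [_] := card_word_act_cat c [:: k] v.
    by apply/setP => x; rewrite !inE.
  have step k X : isfib X -> mass p X = mass p B -> mass p (c k @^-1: X) = mass p B.
    move=> fX mX; apply/eqP; rewrite eq_le maxB ?fpre //= leNgt; apply/negP => lt.
    have : \sum_i mass p (c i @^-1: X) < \sum_(i < d) mass p B.
      rewrite (bigD1 k) //= [X in _ < X](bigD1 k) //= ltr_leD //.
      by apply: ler_sum => k' _; apply: maxB; apply: fpre.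
    by rewrite pinv mX sumr_const card_ord mulr_natl ltxx.
  have -> : word_act c (i :: w) @^-1: B' = c i @^-1: (word_act c w @^-1: B').
    by apply/setP => x; rewrite !inE.
  have fw v X : isfib X -> isfib (word_act c v @^-1: X).
    elim: v => [|k v IHv] fX.
      by rewrite (_ : _ @^-1: X = X) //; apply/setP => x; rewrite !inE.
    rewrite (_ : _ @^-1: X = c k @^-1: (word_act c v @^-1: X)) ?fpre ?IHv //.
    by apply/setP => x; rewrite !inE.
  by apply: step; [exact: fw | exact: IH].
have /asboolP[g [b [rg Bdef]]] := fibB.
have sum_im w :
    \sum_(j in word_act c w @: [set: T]) mass p (word_act c w @^-1: [set j]) = 1.
  rewrite -sum_fibers -p1; apply: eq_bigl => x.
  by rewrite imset_f // inE.
(* B is not empty: otherwise every fiber has mass at most 0, and these masses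
   add up to 1. *)
have [t tB] : exists t, t \in B.
  apply/set0Pn/eqP => B0; have := sum_im g.
  have: \sum_(j in word_act c g @: [set: T]) mass p (word_act c g @^-1: [set j]) <= 0.
    apply: sumr_le0 => j _; rewrite -[X in _ <= X](_ : mass p B = 0).
      by apply: maxB; apply/asboolP; exists g, j.
    by rewrite B0 /mass big_set0.
  by move=> /[swap] ->; rewrite ler10.
have massg j :
    j \in word_act c g @: [set: T] -> mass p (word_act c g @^-1: [set j]) = mass p B.
  case/imsetP => x _ ->; have [w hw] := trans (word_act c g x) t.
  rewrite -(max_pre (g ++ w) B) //; congr mass; apply/setP => y.
  rewrite !inE word_act_cat; apply/eqP/idP => [->|yB]; first by rewrite hw.
  have im : word_act c (g ++ (w ++ g)) @: [set: T] =
      word_act c (w ++ g) @: (word_act c g @: [set: T]).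
    by rewrite -imset_comp; apply: eq_imset => z /=; exact: word_act_cat.
  have inj : {in word_act c g @: [set: T] &, injective (word_act c (w ++ g))}.
    apply/imset_injP; rewrite -im eqn_leq; apply/andP; split.
      by have [] := card_word_act_cat c g (w ++ g).
    by rewrite rg rmin.
  (* Points of distinct fibers of g keep distinct images under w ++ g. *)
  apply: inj; rewrite ?imset_f ?inE // !word_act_cat.
  move: yB tB; rewrite -hw Bdef !inE => /eqP -> /eqP ->.
  by [].
have rB : r%:R * mass p B = 1.
  rewrite -[RHS](sum_im g); under [RHS]eq_bigr do rewrite massg //.
  by rewrite sumr_const rg -[RHS]mulr_natl.
have r0 : r%:R != 0 :> R by apply: contra_eq_neq rB => ->; rewrite mul0r eq_sym oner_neq0.
have -> : r%:R^-1 = mass p B by rewrite -(mulKf r0 (mass p B)) rB mulr1.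
apply/eqP; rewrite eq_le maxB //= leNgt; apply/negP => lt.
have : \sum_(j in word_act c w1 @: [set: T]) mass p (word_act c w1 @^-1: [set j])
     < \sum_(j in word_act c w1 @: [set: T]) mass p B.
  rewrite (bigD1 j1) //= [X in _ < X](bigD1 j1) //= ltr_leD //.
  by apply: ler_sum => j _; apply: maxB; apply/asboolP; exists w1, j.
by rewrite sum_im sumr_const rw1 -mulr_natl rB ltxx.
Qed.

(** When f is injective on I, it stays so on I + i exactly if f i is not in f(I),
    that is, if i is outside the #|I| fibers over f(I), each of mass 1/r; such an
    i lies outside I.  When f is not injective on I, both sides vanish. *)
Lemma mean_injective_extension (R : realFieldType) (T : finType) (p : T -> R) (f : T -> T)
    (r : nat) (I : {set T}) :
  \sum_x p x = 1 ->
  (forall j, j \in f @: [set: T] -> mass p (f @^-1: [set j]) = r%:R^-1) ->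
  \sum_(i | i \notin I) p i * (#|f @: (i |: I)| == #|I|.+1)%:R =
  (1 - #|I|%:R / r%:R) * (#|f @: I| == #|I|)%:R.
Proof.
move=> p1 hf.
have cardI i : #|f @: (i |: I)| = ((f i \notin f @: I) + #|f @: I|)%N.
  by rewrite imsetU1 cardsU1.
case: eqP => [eI|neI]; last first.
  rewrite mulr0 big1 // => i _; rewrite cardI.
  have lt : (#|f @: I| < #|I|)%N by rewrite ltn_neqAle leq_imset_card andbT; apply/eqP.
  by rewrite ltn_eqF ?mulr0 // ltnS (leq_trans _ lt) // -add1n leq_add2r leq_b1.
have -> : 1 - #|I|%:R / r%:R = \sum_(i | f i \notin f @: I) p i :> R.
  rewrite -[X in X - _]p1 (bigID (fun i => f i \in f @: I)) /= sum_fibers.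
  rewrite (eq_bigr (fun=> r%:R^-1)) => [|j jI]; last first.
    by apply: hf; apply: fintype.subsetP jI; rewrite imsetS ?finset.subsetT.
  by rewrite sumr_const eI -[_ *+ _]mulr_natl addrAC subrr add0r.
rewrite mulr1 (bigID (fun i => f i \in f @: I)) /=.
rewrite big1 ?add0r => [|i /andP[_ fi]]; last first.
  by rewrite cardI fi /= add0n eI ltn_eqF ?mulr0.
apply: eq_big => [i|i /andP[_ fi]].
  by case: (boolP (i \in I)) => //= iI; rewrite imset_f.
by rewrite cardI fi eI add1n eqxx mulr1.
Qed.

Local Open Scope classical_set_scope.
Local Open Scope ring_scope.

(** * Mean ergodic theorem for power-bounded matrices *)

Lemma linear_growth_eq0 (R : archiRealFieldType) (x B : R) :
  (forall m : nat, m%:R * `|x| <= B) -> x = 0.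
Proof.
move=> hB; apply/eqP/negPn/negP => x0.
have x_gt0 : 0 < `|x| by rewrite normr_gt0.
have B0 : 0 <= B by rewrite (le_trans _ (hB 0)) // mul0r.
have hlt : B / `|x| < (Num.bound (B / `|x|))%:R.
  by have := archi_boundP (divr_ge0 B0 (normr_ge0 x)).
by have := hB (Num.bound (B / `|x|)); rewrite leNgt -ltr_pdivrMr // hlt.
Qed.

Lemma mulmx_entry_bounded (R : realType) (m n q : nat) (M : 'M[R]_(m, n))
    (N : nat -> 'M[R]_(n, q)) (B : R) :
  (forall k i j, `|N k i j| <= B) ->
  exists2 D : R, 0 <= D & forall k i j, `|(M *m N k) i j| <= D.
Proof.
move=> hN; exists (\sum_i \sum_j `|M i j| * `|B|).
  by apply: sumr_ge0 => i _; apply: sumr_ge0 => j _; rewrite mulr_ge0.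
move=> k i j; rewrite mxE (le_trans (ler_norm_sum _ _ _)) //.
rewrite (bigD1 i) //= ler_wpDr //.
  by apply: sumr_ge0 => i' _; apply: sumr_ge0 => j' _; rewrite mulr_ge0.
apply: ler_sum => x _; rewrite normrM ler_wpM2l //.
by rewrite (le_trans (hN _ _ _)) // ler_norm.
Qed.

(** If v = w (A - 1) is fixed by A then w A^m = w + m v, which is bounded in m
    only if v = 0. *)
Lemma ker_capmx_im_eq0 (R : realType) (n : nat) (A : 'M[R]_n) (B : R) :
  (forall m i j, `|(A ^+ m) i j| <= B) ->
  (kermx (A - 1%:M) :&: (A - 1%:M) = 0)%MS.
Proof.
move=> hA; apply/eqP; rewrite -submx0; apply/rV_subP => v.
rewrite sub_capmx => /andP[/sub_kermxP vA /submxP[w vw]].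
have vA1 : v *m A = v.
  by apply/eqP; rewrite -subr_eq0 -{2}(mulmx1 v) -mulmxBr vA.
have wA : w *m A = w + v by rewrite vw mulmxBr mulmx1 addrC subrK.
have wAm m : w *m A ^+ m = w + m%:R *: v.
  elim: m => [|m IH]; first by rewrite scale0r addr0; exact: mulmx1.
  have -> : A ^+ m.+1 = A ^+ m *m A by rewrite exprSr.
  by rewrite mulmxA IH mulmxDl wA -scalemxAl vA1 mulrS scalerDl scale1r addrA.
have [D D0 hD] := mulmx_entry_bounded w hA.
suff -> : v = 0 by rewrite sub0mx.
apply/rowP => j; rewrite !mxE.
apply: (@linear_growth_eq0 _ _ (D + `|w 0 j|)) => m.
have -> : m%:R * `|v 0 j| = `|(w *m A ^+ m) 0 j - w 0 j|.
  by rewrite wAm !mxE addrAC subrr add0r normrM normr_nat.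
by rewrite (le_trans (ler_normB _ _)) // lerD.
Qed.

(** By the dimension formula the kernel and the image of A - 1 span the whole
    space; X is the projection onto the kernel along the image. *)
Lemma ergodic_decomposition (R : realType) (n : nat) (A : 'M[R]_n) (B : R) :
  (forall m i j, `|(A ^+ m) i j| <= B) ->
  exists X Y : 'M[R]_n, X *m A = X /\ 1%:M = X + Y *m (A - 1%:M).
Proof.
move=> hA; have cap0 := ker_capmx_im_eq0 hA.
have full : row_full (kermx (A - 1%:M) + (A - 1%:M))%MS.
  apply/eqP; rewrite -[RHS](subnK (rank_leq_row (A - 1%:M))) -mxrank_ker.
  by rewrite -mxrank_sum_cap cap0 mxrank0 addn0.
have /sub_addsmxP[u hu] := submx_full 1%:M full.
exists (u.1 *m kermx (A - 1%:M)), u.2; split=> //.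
apply/eqP; rewrite -subr_eq0 -{2}(mulmx1 (_ *m kermx _)) -mulmxBr.
by rewrite -mulmxA mulmx_ker mulmx0.
Qed.

Lemma cvg_scale_invn_bounded (R : realType) (V : normedModType R)
    (f : nat -> V) (B : R) :
  (forall N, `|f N| <= B) -> N%:R^-1 *: f N @[N --> \oo] --> (0 : V).
Proof.
move=> hf; apply/norm_cvg0P.
have h0 : N%:R^-1 * B @[N --> \oo] --> (0 : R).
  rewrite -(mul0r B); apply: cvgMr_tmp.
  by rewrite -(cvg_shiftS (fun N => N%:R^-1 : R)); exact: cvg_harmonic.
apply: (squeeze_cvgr _ (cvg_cst 0) h0).
by near=> N; rewrite normr_ge0 normrZ ger0_norm ?invr_ge0 // ler_wpM2l ?invr_ge0.
Unshelve. all: by end_near. Qed.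

Lemma mx_norm_le (R : realType) (m n : nat) (M : 'M[R]_(m, n)) (B : R) :
  0 <= B -> (forall i j, `|M i j| <= B) -> `|M| <= B.
Proof.
move=> B0 hM; rewrite /Num.Def.normr/= mx_normrE (bigmax_le _ B0)//= => -[i j] _.
Qed.

(** With 1 = X + Y (A - 1) and X A = X, one gets A^m = X + Y (A^(m+1) - A^m), and
    the sum telescopes to N X plus a bounded term. *)
Lemma cvg_cesaro_expmx (R : realType) (n : nat) (A : 'M[R]_n) (B : R) :
  (forall m i j, `|(A ^+ m) i j| <= B) ->
  cvgn (fun N : nat => N%:R^-1 *: \sum_(1 <= m < N.+1) A ^+ m).
Proof.
move=> hA; have [X [Y [XA XY]]] := ergodic_decomposition hA.
have XAm m : X *m A ^+ m = X.
  elim: m => [|m IH]; first exact: mulmx1.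
  have -> : A ^+ m.+1 = A *m A ^+ m by rewrite exprS.
  by rewrite mulmxA XA.
have Am m : A ^+ m = X + Y *m (A ^+ m.+1 - A ^+ m).
  rewrite -{1}[A ^+ m]mul1mx XY mulmxDl XAm -mulmxA mulmxBl mul1mx.
  by have -> : A ^+ m.+1 = A *m A ^+ m by rewrite exprS.
have sumA N : \sum_(1 <= m < N.+1) A ^+ m = X *+ N + Y *m (A ^+ N.+1 - A).
  elim: N => [|N IH].
    by rewrite big_geq // mulr0n add0r expr1 subrr mulmx0.
  rewrite big_nat_recr //= [A ^+ N.+1]Am IH mulrSr addrACA -mulmxDr; congr (_ + _ *m _).
  by rewrite addrC addrA subrK.
have [D D0 hD] := mulmx_entry_bounded Y (fun m i j => hA m i j).
pose f N : 'M[R]_n := Y *m (A ^+ N.+1 - A).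
have hf N : `|f N| <= D + D.
  apply: mx_norm_le => [|i j]; first exact: addr_ge0.
  rewrite /f mulmxBr !mxE (le_trans (ler_normB _ _)) // lerD //.
    by have := hD N.+1 i j; rewrite mxE.
  by have := hD 1 i j; rewrite expr1 mxE.
apply/cvg_ex; exists (X + 0); rewrite -(cvg_shiftS (fun N => _ *: _)).
apply: (@cvg_trans _ ((fun N : nat => X + N.+1%:R^-1 *: f N.+1) @ \oo)).
  apply: near_eq_cvg; near=> N.
  rewrite /= sumA scalerDr -[X *+ _]scaler_nat scalerA mulVf ?scale1r //.
apply: cvgD; first exact: cvg_cst.
rewrite (cvg_shiftS (fun N => N%:R^-1 *: f N)).
exact: cvg_scale_invn_bounded hf.
Unshelve. all: by end_near. Qed.

(** * Matrices of functions and the kernel of the semigroup *)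

Definition fun_mx (R : realType) (n : nat) (f : 'I_n -> 'I_n) : 'M[R]_n :=
  \matrix_(x, y) (f x == y)%:R.

Lemma binary_stochastic_fun_mx (R : realType) (n : nat) (F : 'M[R]_n) :
  binary_stochastic F -> F = fun_mx R (fun_of_mx F).
Proof.
move=> [F01 F1]; apply/matrixP => x y; rewrite mxE /fun_of_mx.
have [z [Fz zuniq]] := F1 x.
case: pickP => [t /eqP Ft /=|none]; last by have := none z; rewrite Fz eqxx.
have [<-|ty] := eqVneq t y; first exact: Ft.
case: (F01 x y) => // Fy; case/eqP: ty.
by rewrite -(zuniq _ Ft) -(zuniq _ Fy).
Qed.

Lemma sum_delta (R : realFieldType) (T : finType) (P : pred T) (F : T -> R) x :
  \sum_(z | P z) (x == z)%:R * F z = if P x then F x else 0.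
Proof.
case: ifP => Px; last first.
  rewrite big1 // => z Pz; case: eqP => [xz|]; last by rewrite mul0r.
  by rewrite xz Pz in Px.
rewrite (bigD1 x) //= eqxx mul1r big1 ?addr0 // => z /andP[_ /negbTE zx].
by rewrite eq_sym zx mul0r.
Qed.

Lemma mul_fun_mx (R : realType) (n : nat) (f g : 'I_n -> 'I_n) :
  fun_mx R f *m fun_mx R g = fun_mx R (g \o f).
Proof.
apply/matrixP => x y; rewrite !mxE /=.
by under eq_bigr do rewrite !mxE; rewrite sum_delta.
Qed.

(** Factor f through its image: the matrix of the surjection onto f(T) has a left
    inverse, given by a section, and that of the inclusion has a right inverse,
    its transpose. *)
Lemma mxrank_fun_mx (R : realType) (n : nat) (f : 'I_n -> 'I_n) :
  \rank (fun_mx R f) = #|f @: [set: 'I_n]%SET|.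
Proof.
set S := f @: _.
pose G : 'M[R]_(n, #|S|) := \matrix_(x, a) (f x == enum_val a)%:R.
pose H : 'M[R]_(#|S|, n) := \matrix_(a, y) (enum_val a == y)%:R.
have -> : fun_mx R f = G *m H.
  apply/matrixP => x y; rewrite !mxE; under eq_bigr do rewrite !mxE.
  rewrite -(big_enum_val (fun z => (f x == z)%:R * (z == y)%:R)) /=.
  by rewrite sum_delta imset_f ?inE.
have Hfree : row_free H.
  apply/row_freeP; exists H^T; apply/matrixP => a b; rewrite !mxE.
  under eq_bigr do rewrite !mxE.
  by rewrite sum_delta (inj_eq enum_val_inj) eq_sym.
rewrite mxrankMfree //; apply/eqP; apply/row_fullP.
have /choice[s hs] : forall a : 'I_#|S|, exists x, f x = enum_val a.
  by move=> a; have /imsetP[x _ ->] := enum_valP a; exists x.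
exists (\matrix_(a, x) (s a == x)%:R); apply/matrixP => a b; rewrite !mxE.
under eq_bigr do rewrite !mxE.
by rewrite sum_delta hs (inj_eq enum_val_inj).
Qed.

Lemma fun_mx_word_cons (R : realType) (n d : nat) (c : 'I_d -> 'I_n -> 'I_n) i w :
  fun_mx R (word_act c (i :: w)) = fun_mx R (c i) *m fun_mx R (word_act c w).
Proof. by rewrite mul_fun_mx. Qed.

Lemma fun_mx_id (R : realType) (n : nat) : fun_mx R (@id 'I_n) = 1%:M.
Proof. by apply/matrixP => x y; rewrite !mxE. Qed.

Lemma generated_semigroup_word (R : realType) (n d : nat)
    (c : 'I_d -> 'I_n -> 'I_n) (M : 'M[R]_n) :
  generated_semigroup (range (fun i => fun_mx R (c i))) M ->
  exists w, M = fun_mx R (word_act c w).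
Proof.
move=> hM; apply: (hM [set M | exists w, M = fun_mx R (word_act c w)]).
split=> /= [M1 M2 [w ->] [v ->]|_ [i _ <-]]; last by exists [:: i].
exists (w ++ v); rewrite mul_fun_mx; congr fun_mx.
by apply/funext => x /=; rewrite word_act_cat.
Qed.

(** The product of any word with an element F of the kernel lies in the kernel
    and has rank r, so the word itself has rank at least r; F is a word of
    rank r. *)
Lemma kernel_word_rank (R : realType) (n d r : nat)
    (c : 'I_d -> 'I_n -> 'I_n) (K : set 'M[R]_n) :
  semigroup_kernel (generated_semigroup (range (fun i => fun_mx R (c i)))) K ->
  (forall F, K F -> \rank F = r) ->
  (forall w, r <= #|word_act c w @: [set: 'I_n]%SET|)%N /\
  exists w, #|word_act c w @: [set: 'I_n]%SET| = r.
Proof.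
move=> [[[F KF] Ksub Kid] _] Kr; split.
  move=> w; rewrite -(mxrank_fun_mx R).
  suff /Kr <- : K (fun_mx R (word_act c w) *m F) by exact: mxrankM_maxl.
  elim: w => [|i w IH]; first by rewrite fun_mx_id mul1mx.
  rewrite fun_mx_word_cons -mulmxA.
  have Si : generated_semigroup (range (fun i => fun_mx R (c i))) (fun_mx R (c i)).
    by apply: sub_gen_smallest; exists i.
  by have [] := Kid _ _ Si IH.
have [w Fw] := generated_semigroup_word (Ksub _ KF).
by exists w; rewrite -(mxrank_fun_mx R) -Fw Kr.
Qed.

Lemma expmx_word (R : realType) (n d k : nat) (c : 'I_d -> 'I_n -> 'I_n) x y :
  ((d%:R^-1 *: \sum_i fun_mx R (c i)) ^+ k) x y != 0 ->
  exists w, word_act c w x = y.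
Proof.
set A := (X in X ^+ k).
elim: k x => [|k IH] x.
  have -> : A ^+ 0 = 1%:M by [].
  rewrite mxE; have [<- _|_] := eqVneq x y; first by exists [::].
  by rewrite eqxx.
have -> : A ^+ k.+1 = A *m A ^+ k by rewrite exprS.
rewrite mxE => sum_neq0.
have [z hz] : exists z, A x z * (A ^+ k) z y != 0.
  apply: contrapT => none; case/eqP: sum_neq0; rewrite big1 // => z _.
  by apply/eqP/negPn/negP => hz; apply: none; exists z.
have /IH[w <-] : (A ^+ k) z y != 0 by apply: contra_neq hz => ->; rewrite mulr0.
have Axz : A x z != 0 by apply: contra_neq hz => ->; rewrite mul0r.
have [i <-] : exists i, c i x = z; last by exists (i :: w).
apply: contrapT => none; case/eqP: Axz.
rewrite /A mxE summxE big1 ?mulr0 // => i _; rewrite mxE.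
by case: eqP => // ciz; case: none; exists i.
Qed.

(** The invariance p A = p, read on sets of vertices: averaging over the letters
    preserves the mass of a set, as Friedman's argument requires. *)
Lemma invariant_preimage_mass (R : realType) (n d : nat) (c : 'I_d -> 'I_n -> 'I_n)
    (p : 'rV[R]_n) (B : {set 'I_n}) :
  (0 < d)%N -> p *m (d%:R^-1 *: \sum_i fun_mx R (c i)) = p ->
  \sum_i mass (p 0) (c i @^-1: B) = d%:R * mass (p 0) B.
Proof.
move=> d0 pA.
have e i : mass (p 0) (c i @^-1: B) = \sum_(y in B) mass (p 0) (c i @^-1: [set y]%SET).
  by rewrite -sum_fibers; apply: eq_bigl => x; rewrite inE.
under eq_bigr do rewrite e; rewrite exchange_big /= /mass mulr_sumr.
apply: eq_bigr => y _; rewrite -[in RHS]pA -scalemxAr mxE.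
rewrite mulVKf ?pnatr_eq0 -?lt0n // mxE.
under [RHS]eq_bigr do rewrite summxE mulr_sumr; rewrite exchange_big /=.
apply: eq_bigr => i _; rewrite big_mkcond /=; apply: eq_bigr => x _.
by rewrite !inE !mxE; case: eqP => _; rewrite ?mulr1 ?mulr0.
Qed.

(** * Level matrices and frequencies of injectivity *)

Lemma sum_nth_subset (R : realType) (n l : nat) (F : {set 'I_n} -> R) :
  \sum_(b < nsub n l) F (nth_subset b) = \sum_(J : {set 'I_n} | #|J| == l) F J.
Proof.
rewrite /nsub /nth_subset -(big_enum_val F).
by apply: eq_bigl => J; rewrite inE.
Qed.

Lemma card_nth_subset (n l : nat) (a : 'I_(nsub n l)) : #|nth_subset a| = l.
Proof. by have := enum_valP a; rewrite inE => /eqP. Qed.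

Lemma nth_subset_onto (n l : nat) (I : {set 'I_n}) :
  #|I| = l -> exists a : 'I_(nsub n l), nth_subset a = I.
Proof.
move=> cI; have hI : I \in [set I : {set 'I_n} | #|I| == l]%SET by rewrite inE cI.
by exists (enum_rank_in hI I); exact: enum_rankK_in.
Qed.

(** A letter c either maps an l-element set S to an l-element set c(S), which is
    the only nonzero entry in row S of its level matrix, or collapses S; then
    that row is 0, and no word that starts with c is injective on S. *)
Lemma level_mx_pow_rowsum (R : realType) (n d l m : nat) (C : 'I_d -> 'M[R]_n) a :
  \sum_b (level_mx C l ^+ m) a b =
  word_mean m (fun w =>
    (#|word_act (fun i => fun_of_mx (C i)) w @: nth_subset a| == l)%:R).
Proof.
pose c i := fun_of_mx (C i); rewrite -/c.
elim: m a => [|m IH] a.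
  have -> : level_mx C l ^+ 0 = 1%:M by [].
  rewrite (eq_bigr (fun b => (a == b)%:R * 1)) => [|b _]; last by rewrite mxE mulr1.
  rewrite (sum_delta predT (fun=> 1)) /=.
  by rewrite (_ : _ @: _ = nth_subset a) ?card_nth_subset ?eqxx // imset_id.
have -> : level_mx C l ^+ m.+1 = level_mx C l *m level_mx C l ^+ m by rewrite exprS.
under eq_bigr do rewrite mxE.
rewrite exchange_big /=; under eq_bigr do rewrite -mulr_sumr IH.
pose E (J : {set 'I_n}) := word_mean (R := R) m (fun w => (#|word_act c w @: J| == l)%:R).
transitivity (d%:R^-1 * \sum_i \sum_(b < nsub n l)
    ((c i @: nth_subset a == nth_subset b)%:R * E (nth_subset b))).
  rewrite exchange_big mulr_sumr /=; apply: eq_bigr => b _.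
  rewrite mxE -mulrA summxE mulr_suml; congr (_ * _).
  by apply: eq_bigr => i _; rewrite mxE.
congr (_ * _); apply: eq_bigr => i _.
rewrite (sum_nth_subset l (fun J => (c i @: nth_subset a == J)%:R * E J)) sum_delta.
have wcons w : word_act c (i :: w) @: nth_subset a =
    word_act c w @: (c i @: nth_subset a) by rewrite -imset_comp.
under [RHS]eq_word_mean do rewrite wcons.
case: eqP => // cl; rewrite -[LHS](mul0r (word_mean m (fun _ : seq 'I_d => 0 : R))).
rewrite -word_meanZ; apply: eq_word_mean => w; rewrite mul0r ltn_eqF //.
apply: leq_ltn_trans (leq_imset_card _ _) _.
rewrite ltn_neqAle; apply/andP; split; first exact/eqP.
by rewrite -[X in (_ <= X)%N](card_nth_subset a) leq_imset_card.
Qed.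

Lemma level_mx_pow_bounded (R : realType) (n d l : nat) (C : 'I_d -> 'M[R]_n) :
  (0 < d)%N -> forall m a b, `|(level_mx C l ^+ m) a b| <= 1.
Proof.
move=> d0 m a b.
have ge0 k x y : 0 <= (level_mx C l ^+ k) x y.
  elim: k x => [|k IH] x.
    by have -> : level_mx C l ^+ 0 = 1%:M by []; rewrite mxE.
  have -> : level_mx C l ^+ k.+1 = level_mx C l *m level_mx C l ^+ k by rewrite exprS.
  rewrite mxE sumr_ge0 // => z _; rewrite mulr_ge0 // mxE mulr_ge0 ?invr_ge0 //.
  by rewrite summxE sumr_ge0 // => i _; rewrite mxE.
rewrite ger0_norm //; apply: (@le_trans _ _ (\sum_y (level_mx C l ^+ m) a y)).
  by rewrite (bigD1 b) //= lerDl sumr_ge0.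
rewrite level_mx_pow_rowsum -(word_mean_cst m 1 d0); apply: ler_word_mean => w.
by rewrite word_mean_cst // lern1 leq_b1.
Qed.

Definition injectivity_freq (R : realType) (n d : nat) (c : 'I_d -> 'I_n -> 'I_n)
    (I : {set 'I_n}) (N : nat) : R :=
  N%:R^-1 * \sum_(1 <= m < N.+1)
    word_mean m (fun w => (#|word_act c w @: I| == #|I|)%:R).

Lemma Omega_ones_cvg (R : realType) (n d l : nat) (C : 'I_d -> 'M[R]_n) a :
  (0 < d)%N ->
  injectivity_freq R (fun i => fun_of_mx (C i)) (nth_subset a) N @[N --> \oo]
    --> (Omega C l *m (ones R (nsub n l))^T) a 0.
Proof.
move=> d0.
have hcvg : (fun N : nat => N%:R^-1 *: \sum_(1 <= m < N.+1) level_mx C l ^+ m)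
    @ \oo --> Omega C l.
  exact: cvg_cesaro_expmx (level_mx_pow_bounded (l := l) C d0).
have -> : (Omega C l *m (ones R (nsub n l))^T) a 0 = \sum_b Omega C l a b.
  by rewrite mxE; apply: eq_bigr => b _; rewrite !mxE mulr1.
have -> : injectivity_freq R (fun i => fun_of_mx (C i)) (nth_subset a) =
    (fun N : nat => \sum_b
       (N%:R^-1 *: \sum_(1 <= m < N.+1) level_mx C l ^+ m : 'M[R]_(nsub n l)) a b).
  apply/funext => N; under [RHS]eq_bigr do rewrite mxE summxE.
  rewrite -mulr_sumr exchange_big /=; congr (_ * _); apply: eq_bigr => m _.
  by rewrite level_mx_pow_rowsum card_nth_subset.
apply: (cvg_big pseudometric_normed_Zmodule.add_continuous) => b _.
apply: (@continuous_cvg _ _ _ \oo _ _ (fun M : 'M[R]_(nsub n l) => M a b) _ _ hcvg).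
exact: coord_continuous.
Qed.

(** The identity of [mean_injective_extension] holds for the words of minimal
    rank; on the other words its two sides differ by at most 1.  As the
    proportions of the latter have bounded partial sums, the Cesaro means of the
    difference tend to 0. *)
Lemma limit_extension_identity (R : realType) (n d r : nat)
    (c : 'I_d -> 'I_n -> 'I_n) (p : 'I_n -> R) (h : {set 'I_n} -> R) (I : {set 'I_n}) :
  (0 < d)%N -> (forall i, 0 <= p i) -> \sum_i p i = 1 ->
  (forall w, r <= #|word_act c w @: [set: 'I_n]%SET|)%N ->
  (exists w, #|word_act c w @: [set: 'I_n]%SET| = r) ->
  (forall w, #|word_act c w @: [set: 'I_n]%SET| = r ->
     forall j, j \in word_act c w @: [set: 'I_n]%SET ->
     mass p (word_act c w @^-1: [set j]%SET) = r%:R^-1) ->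
  (#|I| <= r)%N ->
  (forall J, injectivity_freq R c J N @[N --> \oo] --> h J) ->
  \sum_(i | i \notin I) p i * h (i |: I) = (1 - #|I|%:R / r%:R) * h I.
Proof.
move=> d0 p0 p1 rmin [w0 rw0] fibers Ir hh.
pose F N : R := \sum_(i | i \notin I) p i * injectivity_freq R c (i |: I) N -
  (1 - #|I|%:R / r%:R) * injectivity_freq R c I N.
pose chi (J : {set 'I_n}) w : R := (#|word_act c w @: J| == #|J|)%:R.
pose delta w : R := \sum_(i | i \notin I) p i * chi (i |: I) w -
  (1 - #|I|%:R / r%:R) * chi I w.
pose bad w := #|word_act c w @: [set: 'I_n]%SET| != r.
have FE N : F N = N%:R^-1 * \sum_(1 <= m < N.+1) word_mean m delta.
  rewrite /F /delta; under [in RHS]eq_bigr do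
    rewrite word_meanB word_meanZ word_mean_sum.
  rewrite sumrB mulrBr; congr (_ - _).
    rewrite exchange_big /= mulr_sumr; apply: eq_bigr => i _.
    under [in RHS]eq_bigr do rewrite word_meanZ.
    by rewrite -mulr_sumr mulrCA.
  by rewrite -mulr_sumr mulrCA.
have chi01 J w : 0 <= chi J w <= 1 by rewrite /chi ler0n lern1 leq_b1.
have cIr : 0 <= (1 - #|I|%:R / r%:R : R) <= 1.
  rewrite subr_ge0 lerBlDr lerDl divr_ge0 // andbT.
  case: (posnP r) => [r0|r0]; first by rewrite r0 invr0 mulr0 ler01.
  by rewrite ler_pdivrMr ?ltr0n // mul1r ler_nat.
have delta_le w : `|delta w| <= (bad w)%:R.
  rewrite /bad; case: eqP => [rw|_] /=.
    rewrite normr_le0 subr_eq0; apply/eqP.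
    rewrite -(mean_injective_extension I p1 (fibers w rw)).
    by apply: eq_bigr => i iI; rewrite /chi cardsU1 iI.
  (* On the remaining words both terms of delta lie between 0 and 1. *)
  have sum01 : 0 <= \sum_(i | i \notin I) p i * chi (i |: I) w <= 1.
    apply/andP; split.
      by apply: sumr_ge0 => i _; rewrite mulr_ge0 //; case/andP: (chi01 (i |: I) w).
    rewrite -p1 [X in _ <= X](bigID (fun i => i \notin I)) /= ler_wpDr ?sumr_ge0 //.
    apply: ler_sum => i _; rewrite -[X in _ <= X]mulr1 ler_wpM2l //.
    by case/andP: (chi01 (i |: I) w).
  have prod01 : 0 <= (1 - #|I|%:R / r%:R) * chi I w <= 1.
    case/andP: (chi01 I w) => x0 x1; case/andP: cIr => y0 y1.
    by rewrite mulr_ge0 // mulr_ile1.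
  case/andP: sum01 => a0 a1; case/andP: prod01 => b0 b1.
  rewrite /delta ler_norml; apply/andP; split.
    by rewrite lerBrDr addrC (le_trans _ a0) // subr_le0.
  by rewrite lerBlDr (le_trans a1) // lerDl.
have bad_cat w v : bad (w ++ v) -> bad w && bad v.
  rewrite /bad => hb; have [h1 h2] := card_word_act_cat c w v.
  by apply/andP; split; apply: contra hb => /eqP e; rewrite eqn_leq rmin andbT -e.
have good0 : ~~ bad w0 by rewrite negbK rw0.
have [B hB] := sum_word_mean_bounded R d0 bad_cat good0.
have F0 : F N @[N --> \oo] --> (0 : R).
  have -> : F = fun N : nat =>
      N%:R^-1 *: (\sum_(1 <= m < N.+1) word_mean m delta : R^o).
    by apply/funext => N; rewrite FE.
  apply: (@cvg_scale_invn_bounded _ _ _ B) => N.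
  apply: le_trans (hB N); apply: le_trans (ler_norm_sum _ _ _) _.
  apply: ler_sum => m _; rewrite ler_norml -[- word_mean m _]mulN1r -word_meanZ.
  apply/andP; split; apply: ler_word_mean => w.
    by rewrite mulN1r lerNl (le_trans (ler_norm _)) // normrN.
  exact: le_trans (ler_norm _) (delta_le w).
apply/eqP; rewrite -subr_eq0; apply/eqP.
apply: (cvg_unique _ _ F0) => //.
apply: cvgB.
  apply: (cvg_big pseudometric_normed_Zmodule.add_continuous) => i _.
  by apply: cvgMl_tmp; exact: hh.
by apply: cvgMl_tmp; exact: hh.
Qed.

(** * The theorem *)

Theorem mainTheorem14
  (R : realType) (n d : nat)
  (adj : 'M[nat]_n) (hadj : out_regular d adj)
  (hirr : irreducible_mx (d%:R^-1 *: real_adj R adj))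
  (haper : aperiodic_mx (d%:R^-1 *: real_adj R adj))
  (p : 'rV[R]_n)
  (hp : invariant_distribution (d%:R^-1 *: real_adj R adj) p)
  (C : 'I_d -> 'M[R]_n)
  (hC : forall i, binary_stochastic (C i))
  (hsum : real_adj R adj = \sum_i C i)
  (K : set 'M[R]_n)
  (hK : semigroup_kernel (generated_semigroup (range C)) K)
  (r : nat) (hr : forall F, K F -> \rank F = r)
  (u : nat -> {set 'I_n} -> R)
  (hur : (subset_vec r (u r))^T = Omega C r *m (ones R (nsub n r))^T)
  (hu : forall l, (1 <= l < r)%N -> forall I : {set 'I_n}, #|I| = l ->
     u l I = \sum_(i | i \notin I) p 0 i * u l.+1 (i |: I)%SET) :
  forall l, (1 <= l <= r)%N ->
    exists c : R,
      (subset_vec l (u l))^T = c *: (Omega C l *m (ones R (nsub n l))^T).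
Proof.
have [p0 p1 pA] := hp.
(* If d = 0 then A = 0, so p = p A = 0, which is not a distribution. *)
have d0 : (0 < d)%N.
  rewrite lt0n; apply/eqP => d0; move: p1.
  rewrite big1 => [/esym/eqP|i _]; first by rewrite oner_eq0.
  by rewrite -pA d0 invr0 scale0r mulmx0 mxE.
pose c i := fun_of_mx (C i).
have CE : C = fun i => fun_mx R (c i).
  by apply/funext => i; exact: binary_stochastic_fun_mx.
have AE : d%:R^-1 *: real_adj R adj = d%:R^-1 *: \sum_i fun_mx R (c i).
  by rewrite hsum; congr (_ *: _); apply: eq_bigr => i _; rewrite {1}CE.
rewrite AE in hirr pA; rewrite CE in hK.
have [rmin rmem] := kernel_word_rank hK hr.
have trans x y : exists w, word_act c w x = y.
  have [k _ hk] := hirr x y; apply: (@expmx_word R n d k).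
  by rewrite gt_eqF.
have fibers := minimal_rank_fiber_mass d0 p1
  (fun B => invariant_preimage_mass B d0 pA) trans rmin.
have cvgI I : exists x : R, injectivity_freq R c I N @[N --> \oo] --> x.
  have [a <-] := nth_subset_onto (erefl #|I|).
  by eexists; exact: Omega_ones_cvg.
have /choice[h hh] := cvgI.
have OmegaE l (a : 'I_(nsub n l)) :
    (Omega C l *m (ones R (nsub n l))^T) a 0 = h (nth_subset a).
  have hO : injectivity_freq R c (nth_subset a) N @[N --> \oo] -->
    (Omega C l *m (ones R (nsub n l))^T) a 0 by exact: Omega_ones_cvg.
  by rewrite -(cvg_lim _ hO) // (cvg_lim _ (hh (nth_subset a))).
have descent k : (k < r)%N -> exists x : R,
    forall I : {set 'I_n}, #|I| = (r - k)%N -> u (r - k)%N I = x * h I.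
  elim: k => [_|k IH kr].
    exists 1 => I; rewrite subn0 mul1r => cI.
    have [a aI] := nth_subset_onto cI; rewrite -aI -OmegaE -hur.
    by rewrite !mxE.
  have [x hx] := IH (ltnW kr); pose l := (r - k.+1)%N.
  have lS : (r - k)%N = l.+1 by rewrite /l -subSn // ltnW.
  rewrite lS in hx.
  have l0 : (0 < l)%N by rewrite subn_gt0.
  have lr : (l < r)%N by rewrite -lS leq_subr.
  exists (x * (1 - l%:R / r%:R)) => I cI.
  rewrite hu ?l0 //; transitivity (x * \sum_(i | i \notin I) p 0 i * h (i |: I)%SET).
    rewrite mulr_sumr; apply: eq_bigr => i iI.
    by rewrite hx ?cardsU1 ?iI ?cI // mulrCA.
  rewrite (limit_extension_identity (r := r) (c := c)) ?cI ?mulrA //.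
  exact: ltnW.
move=> l /andP[l0 lr].
have [|x] := descent (r - l)%N; first by rewrite ltn_subrL l0 (leq_trans l0 lr).
rewrite subKn // => hx; exists x; apply/matrixP => a j.
by rewrite ord1 [in RHS]mxE OmegaE !mxE hx // card_nth_subset.
Qed.
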